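(* A left bialgebroid $(U,B,s,t,\Delta,\varepsilon)$ is an action left bialgebroid (i.e. isomorphic to some $R\#W$) if and only if the following hold: (i) there is a left bialgebroid $(W,A)$ along with a morphism $(F,f):(W,A)\to(U,B)$ of left bialgebroids; (ii) there is a left $B$-linear right $W$-coaction $\rho_U:U\to U_{\triangleleft f}\otimes_A W$ on $U$, in the sense that $\rho_U(b\triangleright u)=b\triangleright\rho_U(u)$, satisfying in addition $(U\otimes_B F)\circ\rho_U=\Delta$, where $U\otimes_BF$ is the composition $U\otimes_A W\hookrightarrow U\otimes_B(B_f\otimes_A W)\xrightarrow{U\otimes_B\xi}U\otimes_B U$ with $\xi(b\otimes_A w)=b\triangleright F(w)$ (so $u\otimes_A w\mapsto u\otimes_B F(w)$); (iii) the map $F:W\to U$ is right $W$-colinear. If conditions (i), (ii) and (iii) hold, one has an isomorphism $$\xi:B_f\otimes_A W\to U,\qquad b\otimes_A w\mapsto b\triangleright F(w)$$ of left $B$-modules, with inverse $u\mapsto\varepsilon(u_{[0]})\otimes_A u_{[1]}$, where $\rho_U(u)=u_{[0]}\otimes_A u_{[1]}$. Finally, $B$ becomes a braided commutative monoid in ${}_W\mathbf{YD}^W$ so that $\xi$ induces an isomorphism $(B\#W,B)\to(U,B)$ of left bialgebroids.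
   Context: Let $k$ be a commutative ring; algebras are unital associative $k$-algebras. LEFT BIALGEBROIDS. A left bialgebroid $(U,A,s,t,\Delta,\varepsilon)$ over the algebra $A$ consists of an algebra $U$, algebra maps $s:A\to U$ (source) and $t:A^{op}\to U$ (target) with commuting images, and maps $\Delta,\varepsilon$ as follows. Write $a\triangleright u\triangleleft b:=s(a)t(b)u$ and $a\blacktriangleright u\blacktriangleleft b:=u\,t(a)s(b)$; triangles as subscripts indicate the module structure used. $\Delta:U\to U_\triangleleft\otimes_A{}_\triangleright U$, $u\mapsto u_{(1)}\otimes_A u_{(2)}$ (so $t(a)u\otimes_A u'=u\otimes_A s(a)u'$) and $\varepsilon:U\to A$ make ${}_\triangleright U_\triangleleft$ an $A$-coring; $\Delta$ takes values in the Takeuchi subspace of elements $\sum_i u_i\otimes_A u_i'$ with $\sum_i u_it(a)\otimes_A u'_i=\sum_i u_i\otimes_A u_i's(a)$ for all $a$, and is a unital algebra map into it; $\varepsilon(1)=1$ and $\varepsilon(uu')=\varepsilon(u\,s(\varepsilon(u')))=\varepsilon(u\,t(\varepsilon(u')))$. Each left $U$-module $M$ is an $A$-bimodule via $a\triangleright m\triangleleft b:=s(a)t(b)m$. A morphism $(F,f):(W,A)\to(U,B)$ of left bialgebroids is a pair of algebra maps $F:W\to U$, $f:A\to B$ with $F\circ s_W=s\circ f$, $F\circ t_W=t\circ f$, $\varepsilon\circ F=f\circ\varepsilon_W$ and $\Delta(F(w))=F(w_{(1)})\otimes_BF(w_{(2)})$. A right $U$-comodule (for $(U,A)$ a left bialgebroid)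 is a right $A$-module $M$ with a right $A$-linear coassociative counital coaction $\rho_M:M\to M\otimes_A{}_\triangleright U$, $m\mapsto m_{[0]}\otimes_A m_{[1]}$; with the induced left action $am:=m_{[0]}\varepsilon(m_{[1]}s(a))$ one has $\rho_M(ama')=m_{[0]}\otimes_A t(a')m_{[1]}t(a)$ and $am_{[0]}\otimes_A m_{[1]}=m_{[0]}\otimes_A m_{[1]}s(a)$. ${}_U\mathbf{YD}^U$: objects are left $U$-modules and right $U$-comodules $M$ for which the two $A$-bimodule structures coincide and $u_{(1)}m_{[0]}\otimes_A u_{(2)}m_{[1]}=(u_{(2)}m)_{[0]}\otimes_A(u_{(2)}m)_{[1]}u_{(1)}$. A monoid in ${}_U\mathbf{YD}^U$ is an object $R$ that is a unital algebra $(R,\cdot)$ with: $u(r\cdot r')=(u_{(1)}r)\cdot(u_{(2)}r')$, $u1_R=\varepsilon(u)\triangleright 1_R$; $a(r\cdot r')=(ar)\cdot r'$, $(r\cdot r')a=r\cdot(r'a)$, $(ra)\cdot r'=r\cdot(ar')$; $(r\cdot r')_{[0]}\otimes_A(r\cdot r')_{[1]}=r_{[0]}\cdot r'_{[0]}\otimes_A r'_{[1]}r_{[1]}$, $1_{[0]}\otimes_A1_{[1]}=1_R\otimes_A1_U$. It is braided commutative if $r\cdot r'=r'_{[0]}\cdot(r'_{[1]}r)$ for all $r,r'$. ACTION BIALGEBROIDS. For $R$ a braided commutative monoid in ${}_U\mathbf{YD}^U$, $R\#U$ denotes $R\otimes_A{}_\triangleright U$ with product $(r\otimes_A u)(r'\otimes_A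 u')=r\cdot(u_{(1)}r')\otimes_A u_{(2)}u'$, source $r\mapsto r\otimes_A1$, target $r\mapsto r_{[0]}\otimes_A r_{[1]}$, coproduct $r\otimes_A u\mapsto(r\otimes_A u_{(1)})\otimes_R(1\otimes_A u_{(2)})$ and counit $r\otimes_A u\mapsto r\varepsilon(u)$; this is a left bialgebroid over $R$. A left bialgebroid of this form (up to isomorphism) is called an action left bialgebroid. NOTATION IN THE CLAIM. $s,t,\Delta,\varepsilon$ without subscripts belong to $U$; those of $W$ carry the subscript $W$. $B_f$ is $B$ as a right $A$-module via $b\cdot a=bf(a)$; $U_{\triangleleft f}$ is $U$ as a right $A$-module via $u\cdot a=t(f(a))u$. $W$ is regarded as a left $A$-module via $\triangleright$ (left multiplication by $s_W$) in $-\otimes_AW$. $b\triangleright\rho_U(u)$ means $s(b)u_{[0]}\otimes_A u_{[1]}$. Colinearity of $F$ means $\rho_U(F(w))=F(w_{(1)})\otimes_A w_{(2)}$. *)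

(* Defs.v *)
From HB Require Import structures.
From mathcomp Require Import all_boot all_algebra.
From mathcomp Require Import boolp.

Set Implicit Arguments.
Unset Strict Implicit.
Unset Printing Implicit Defensive.

Import GRing.Theory.
Local Open Scope ring_scope.
Local Open Scope quotient_scope.

(* Unital associative k-algebras, the zero algebra included; algType excludes  *)
(* it, because it extends nzRingType.  Multiplication is a field of the mixin *)
(* because the join of PzRing and Lmodule is not part of the algebraic        *)
(* hierarchy; every kalgType is a pzRingType by the instance below.           *)
HB.mixin Record Lmodule_isKAlgebra (k : comPzRingType) A
    of GRing.Lmodule k A := {
  kone : A;
  kmul : A -> A -> A;
  kmulA : associative kmul;
  kmul1r : left_id kone kmul;
  kmulr1 : right_id kone kmul;
  kmulDl : left_distributive kmul +%R;
  kmulDr : right_distributive kmul +%R;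
  kmul_scalerAl : forall (c : k) (x y : A), c *: kmul x y = kmul (c *: x) y;
  kmul_scalerAr : forall (c : k) (x y : A), c *: kmul x y = kmul x (c *: y)
}.

#[short(type="kalgType")]
HB.structure Definition KAlgebra (k : comPzRingType) :=
  {A of Lmodule_isKAlgebra k A & GRing.Lmodule k A}.

HB.instance Definition _ (k : comPzRingType) (A : kalgType k) :=
  GRing.Zmodule_isPzRing.Build A
    (@kmulA k A) (@kmul1r k A) (@kmulr1 k A) (@kmulDl k A) (@kmulDr k A).

HB.instance Definition _ (k : comPzRingType) (A : algType k) :=
  Lmodule_isKAlgebra.Build k A
    (@mulrA A) (@mul1r A) (@mulr1 A) (@mulrDl A) (@mulrDr A)
    (@scalerAl k A) (@scalerAr k A).

Lemma kscalerAl (k : comPzRingType) (A : kalgType k) (c : k) (x y : A) :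
  c *: (x * y) = (c *: x) * y.
Proof. exact: kmul_scalerAl. Qed.

Lemma kscalerAr (k : comPzRingType) (A : kalgType k) (c : k) (x y : A) :
  c *: (x * y) = x * (c *: y).
Proof. exact: kmul_scalerAr. Qed.

(* The tensor product of M and N over A, for a right action ra of A on M and  *)
(* a left action la of A on N.  Its elements are the formal finite sums       *)
(* [:: (m_1, n_1); ...; (m_r, n_r)]; two of them are identified when every    *)
(* k-bilinear A-balanced map takes the same value on both.  No law is imposed *)
(* on ra and la here.                                                         *)
Section Tensor.

Context {k : comPzRingType} {A : Type} {M N : lmodType k}.
Variables (ra : M -> A -> M) (la : A -> N -> N).

Definition balanced (V : lmodType k) (g : M -> N -> V) : Prop :=
  [/\ forall n, linear (g^~ n), forall m, linear (g m)
    & forall m a n, g (ra m a) n = g m (la a n)].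

Definition fsum (V : nmodType) (g : M -> N -> V) (s : seq (M * N)) : V :=
  \sum_(p <- s) g p.1 p.2.

Definition tens_rel : rel (seq (M * N)) := fun s s' =>
  `[< forall (V : lmodType k) (g : M -> N -> V),
        balanced g -> fsum g s = fsum g s' >].

Lemma tens_rel_refl : reflexive tens_rel.
Proof. by move=> s; apply/asboolP. Qed.

Lemma tens_rel_sym : symmetric tens_rel.
Proof. by move=> s s'; apply/asboolP/asboolP => h V g hg; rewrite h. Qed.

Lemma tens_rel_trans : transitive tens_rel.
Proof.
move=> s2 s1 s3 /asboolP h12 /asboolP h23; apply/asboolP => V g hg.
by rewrite h12 // h23.
Qed.

Canonical tens_equiv := EquivRel tens_rel tens_rel_refl tens_rel_sym
  tens_rel_trans.

Definition tensor : Type := {eq_quot tens_equiv}.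
HB.instance Definition _ := Choice.on tensor.
HB.instance Definition _ := EqQuotient.on tensor.

Definition tens (m : M) (n : N) : tensor := \pi_tensor [:: (m, n)].

(* tsum z g is the value at z of the map m (x) n |-> g m n.  It is computed   *)
(* on a chosen representative of z, hence meaningful as soon as g is balanced *)
(* (lemma tsumE); it plays the role of Sweedler's notation.                   *)
Definition tsum (V : nmodType) (z : tensor) (g : M -> N -> V) : V :=
  fsum g (repr z).

Let tadd (x y : tensor) : tensor := \pi_tensor (repr x ++ repr y).
Let tscale (c : k) (x : tensor) : tensor :=
  \pi_tensor [seq (c *: p.1, p.2) | p <- repr x].

Lemma eq_tensorP (x y : tensor) :
  (forall (V : lmodType k) (g : M -> N -> V), balanced g ->
     tsum x g = tsum y g) <-> x = y.
Proof.
split=> [h|-> //]; rewrite -[x]reprK -[y]reprK.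
by apply/eqmodP/asboolP => V g hg; apply: h.
Qed.

Lemma tsum_pi (V : lmodType k) (g : M -> N -> V) (s : seq (M * N)) :
  balanced g -> tsum (\pi_tensor s) g = fsum g s.
Proof.
move=> hg; have /eqmodP/asboolP : repr (\pi_tensor s) = s %[mod tensor].
  by rewrite reprK.
exact.
Qed.

Lemma fsum_cat (V : nmodType) (g : M -> N -> V) s s' :
  fsum g (s ++ s') = fsum g s + fsum g s'.
Proof. exact: big_cat. Qed.

Lemma fsum_scale (V : lmodType k) (g : M -> N -> V) c s : balanced g ->
  fsum g [seq (c *: p.1, p.2) | p <- s] = c *: fsum g s.
Proof.
move=> [gl _ _]; rewrite /fsum big_map scaler_sumr.
by apply: eq_bigr => p _ /=; rewrite (scalable_linear (gl p.2)).
Qed.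

Let tsum_add (V : lmodType k) (g : M -> N -> V) x y : balanced g ->
  tsum (tadd x y) g = tsum x g + tsum y g.
Proof. by move=> hg; rewrite tsum_pi // fsum_cat. Qed.

Let tsum_scale (V : lmodType k) (g : M -> N -> V) c x : balanced g ->
  tsum (tscale c x) g = c *: tsum x g.
Proof. by move=> hg; rewrite tsum_pi // fsum_scale. Qed.

Let tsum_0 (V : lmodType k) (g : M -> N -> V) : balanced g ->
  tsum (\pi_tensor [::]) g = 0.
Proof. by move=> hg; rewrite tsum_pi // /fsum big_nil. Qed.

Fact tensor_addA : associative tadd.
Proof. by move=> x y z; apply/eq_tensorP => V g hg; rewrite !tsum_add // addrA. Qed.
Fact tensor_addC : commutative tadd.
Proof. by move=> x y; apply/eq_tensorP => V g hg; rewrite !tsum_add // addrC. Qed.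
Fact tensor_add0 : left_id (\pi_tensor [::]) tadd.
Proof.
by move=> x; apply/eq_tensorP => V g hg; rewrite tsum_add // tsum_0 // add0r.
Qed.
Fact tensor_addN : left_inverse (\pi_tensor [::]) (tscale (-1)) tadd.
Proof.
move=> x; apply/eq_tensorP => V g hg.
by rewrite tsum_add // tsum_scale // tsum_0 // scaleN1r addNr.
Qed.
HB.instance Definition _ := GRing.isZmodule.Build tensor
  tensor_addA tensor_addC tensor_add0 tensor_addN.

Fact tensor_scaleA a b (v : tensor) : tscale a (tscale b v) = tscale (a * b) v.
Proof.
by apply/eq_tensorP => V g hg; rewrite !tsum_scale // scalerA.
Qed.
Fact tensor_scale1 : left_id 1 tscale.
Proof. by move=> v; apply/eq_tensorP => V g hg; rewrite tsum_scale // scale1r. Qed.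
Fact tensor_scaleDr : right_distributive tscale +%R.
Proof.
move=> c x y; apply/eq_tensorP => V g hg.
by rewrite tsum_scale // !tsum_add // !tsum_scale // scalerDr.
Qed.
Fact tensor_scaleDl v : {morph tscale^~ v : a b / a + b}.
Proof.
move=> a b; apply/eq_tensorP => V g hg.
by rewrite tsum_scale // tsum_add // !tsum_scale // scalerDl.
Qed.
HB.instance Definition _ := GRing.Zmodule_isLmodule.Build k tensor
  tensor_scaleA tensor_scale1 tensor_scaleDr tensor_scaleDl.

Lemma tsumE (V : lmodType k) (g : M -> N -> V) m n :
  balanced g -> tsum (tens m n) g = g m n.
Proof. by move=> hg; rewrite tsum_pi // /fsum big_seq1. Qed.

Lemma tsum_linear (V : lmodType k) (g : M -> N -> V) :
  balanced g -> linear (fun z => tsum z g).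
Proof. by move=> hg c x y; rewrite tsum_add // tsum_scale. Qed.

Lemma tens_balanced : balanced tens.
Proof.
split=> [n c m m'|m c n n'|m a n]; apply/eq_tensorP => V g hg;
  case: (hg) => gl gr gb.
- by rewrite tsum_linear // !tsumE // gl.
- by rewrite tsum_linear // !tsumE // gr.
- by rewrite !tsumE // gb.
Qed.

Lemma tsum_tens (z : tensor) : tsum z tens = z.
Proof.
apply/eq_tensorP => V g hg; rewrite /(tsum z tens) /fsum.
have E s : tsum (\sum_(p <- s) tens p.1 p.2) g = fsum g s.
  rewrite /fsum; elim: s => [|p s IHs]; first by rewrite !big_nil tsum_0.
  by rewrite !big_cons tsum_add // tsumE // IHs.
exact: E.
Qed.

Lemma eq_tensor_linear (V : lmodType k) (h h' : {linear tensor -> V}) :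
  (forall m n, h (tens m n) = h' (tens m n)) -> h =1 h'.
Proof.
move=> hh z; rewrite -[z]tsum_tens /tsum /fsum !raddf_sum.
by apply: eq_bigr => p _; apply: hh.
Qed.

End Tensor.

Arguments tens {k A M N ra la} m n.
Arguments tsum {k A M N ra la V} z g.

Notation "x ⊗ y" := (tens x y) (at level 45, left associativity) : ring_scope.
Notation "\tsum_ ( x , y <- z ) E" := (tsum z (fun x y => E))
  (at level 46, E at level 46, x name, y name,
   format "'[' \tsum_ ( x ,  y  <-  z ) '/  '  E ']'") : ring_scope.

(* The right A-module structure (m (x) u) . a = m (x) t(a) u on M (x)_A U. *)
Definition tens_ract {k : comPzRingType} {A U : kalgType k} {M : lmodType k}
    (s t : A -> U) (ra : M -> A -> M)
    (x : tensor ra (fun a u => s a * u)) (a : A) :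
    tensor ra (fun a u => s a * u) :=
  \tsum_(m, u <- x) m ⊗ (t a * u).

Record left_bialgebroid {k : comPzRingType} (A U : kalgType k) :=
    LeftBialgebroid {
  src : A -> U;
  tgt : A -> U;
  comul : U -> tensor (fun u a => tgt a * u) (fun a u => src a * u);
  counit : U -> A;
  src_linear : linear src;
  src1 : src 1 = 1;
  srcM : forall a b : A, src (a * b) = src a * src b;
  tgt_linear : linear tgt;
  tgt1 : tgt 1 = 1;
  tgtM : forall a b : A, tgt (a * b) = tgt b * tgt a;
  src_tgtC : forall a b, src a * tgt b = tgt b * src a;
  comul_linear : linear comul;
  comul_bimod : forall (a b : A) (u : U),
    comul (src a * tgt b * u) =
    \tsum_(u1, u2 <- comul u) (src a * u1) ⊗ (tgt b * u2);
  counit_linear : linear counit;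
  counit_bimod : forall (a b : A) (u : U),
    counit (src a * tgt b * u) = a * counit u * b;
  comulA : forall u,
    \tsum_(u1, u2 <- comul u)
      (comul u1 ⊗ u2 : tensor (@tens_ract _ _ _ _ src tgt _)
                              (fun a u => src a * u)) =
    \tsum_(u1, u2 <- comul u) \tsum_(v1, v2 <- comul u2) (u1 ⊗ v1) ⊗ v2;
  comul_counitl : forall u,
    \tsum_(u1, u2 <- comul u) src (counit u1) * u2 = u;
  comul_counitr : forall u,
    \tsum_(u1, u2 <- comul u) tgt (counit u2) * u1 = u;
  comul_takeuchi : forall a u,
    \tsum_(u1, u2 <- comul u)
      (u1 * tgt a ⊗ u2 : tensor (fun u a => tgt a * u)
                                (fun a u => src a * u)) =
    \tsum_(u1, u2 <- comul u) u1 ⊗ u2 * src a;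
  comul1 : comul 1 = (1 : U) ⊗ (1 : U);
  comulM : forall u v : U,
    comul (u * v) =
    \tsum_(u1, u2 <- comul u) \tsum_(v1, v2 <- comul v) (u1 * v1) ⊗ (u2 * v2);
  counit1 : counit 1 = 1;
  counit_src : forall u v : U, counit (u * v) = counit (u * src (counit v));
  counit_tgt : forall u v : U, counit (u * v) = counit (u * tgt (counit v))
}.

(* The operations of a left bialgebroid without the axioms: this is what a    *)
(* morphism has to preserve.  It allows to speak of R # U before knowing that *)
(* it is a bialgebroid.                                                       *)
Record bialgebroid_data (k : comPzRingType) := BialgebroidData {
  base : kalgType k;
  total : lmodType k;
  dmul : total -> total -> total;
  dunit : total;
  dsrc : base -> total;
  dtgt : base -> total;
  dcomul : total ->
    tensor (fun u b => dmul (dtgt b) u) (fun b u => dmul (dsrc b) u);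
  dcounit : total -> base
}.

Definition bialgebroid_data_of {k : comPzRingType} {A U : kalgType k}
    (H : left_bialgebroid A U) : bialgebroid_data k :=
  @BialgebroidData k A U *%R 1 (src H) (tgt H) (comul H) (counit H).
Coercion bialgebroid_data_of : left_bialgebroid >-> bialgebroid_data.

Record bialgebroid_morphism {k : comPzRingType} (D E : bialgebroid_data k)
    (F : total D -> total E) (f : base D -> base E) : Prop :=
    BialgebroidMorphism {
  bmor_linear : linear F;
  bmor1 : F (dunit D) = dunit E;
  bmorM : forall x y, F (dmul x y) = dmul (F x) (F y);
  bmor_base_linear : linear f;
  bmor_base1 : f 1 = 1;
  bmor_baseM : forall a b : base D, f (a * b) = f a * f b;
  bmor_src : forall a : base D, F (dsrc a) = dsrc (f a);
  bmor_tgt : forall a : base D, F (dtgt a) = dtgt (f a);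
  bmor_counit : forall x, dcounit (F x) = f (dcounit x);
  bmor_comul : forall x,
    dcomul (F x) = \tsum_(x1, x2 <- dcomul x) F x1 ⊗ F x2
}.

Definition bialgebroid_iso {k : comPzRingType} (D E : bialgebroid_data k)
    (F : total D -> total E) (f : base D -> base E) : Prop :=
  [/\ bialgebroid_morphism F f, bijective F & bijective f].

Section YetterDrinfeld.

Context {k : comPzRingType} {A U : kalgType k} (H : left_bialgebroid A U).

Definition lsrc (a : A) (u : U) : U := src H a * u.

Record left_module (M : lmodType k) (act : U -> M -> M) : Prop := LeftModule {
  lmod_linearl : forall m, linear (act^~ m);
  lmod_linearr : forall u, linear (act u);
  lmod1 : forall m, act 1 m = m;
  lmodM : forall (u v : U) m, act (u * v) m = act u (act v m)
}.

Record right_comodule (M : lmodType k) (ra : M -> A -> M)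
    (rho : M -> tensor ra lsrc) : Prop := RightComodule {
  rcom_linearl : forall a, linear (ra^~ a);
  rcom_linearr : forall m, linear (ra m);
  rcom_ract1 : forall m, ra m 1 = m;
  rcom_ractM : forall m (a b : A), ra m (a * b) = ra (ra m a) b;
  rcom_linear : linear rho;
  rcom_ract : forall m a,
    rho (ra m a) = \tsum_(m0, m1 <- rho m) m0 ⊗ (tgt H a * m1);
  rcom_coassoc : forall m,
    \tsum_(m0, m1 <- rho m)
      (rho m0 ⊗ m1 : tensor (@tens_ract _ _ _ _ (src H) (tgt H) ra) lsrc) =
    \tsum_(m0, m1 <- rho m) \tsum_(u1, u2 <- comul H m1) (m0 ⊗ u1) ⊗ u2;
  rcom_counit : forall m, \tsum_(m0, m1 <- rho m) ra m0 (counit H m1) = m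
}.

Definition comodule_lact (M : lmodType k) (ra : M -> A -> M)
    (rho : M -> tensor ra lsrc) (a : A) (m : M) : M :=
  \tsum_(m0, m1 <- rho m) ra m0 (counit H (m1 * src H a)).

Record yd_module (M : lmodType k) (act : U -> M -> M) (ra : M -> A -> M)
    (rho : M -> tensor ra lsrc) : Prop := YDModule {
  yd_left_module : left_module act;
  yd_right_comodule : right_comodule rho;
  yd_lact : forall a m, act (src H a) m = comodule_lact rho a m;
  yd_ract : forall a m, act (tgt H a) m = ra m a;
  yd_compat : forall u m,
    \tsum_(u1, u2 <- comul H u) \tsum_(m0, m1 <- rho m)
      (act u1 m0 ⊗ (u2 * m1) : tensor ra lsrc) =
    \tsum_(u1, u2 <- comul H u) \tsum_(n0, n1 <- rho (act u2 m))
      n0 ⊗ (n1 * u1)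
}.

Record yd_monoid (R : kalgType k) (act : U -> R -> R) (ra : R -> A -> R)
    (rho : R -> tensor ra lsrc) : Prop := YDMonoid {
  ydm_yd : yd_module act rho;
  ydm_actM : forall u (r r' : R),
    act u (r * r') = \tsum_(u1, u2 <- comul H u) act u1 r * act u2 r';
  ydm_act1 : forall u, act u 1 = act (src H (counit H u)) 1;
  ydm_lact : forall a (r r' : R), act (src H a) (r * r') = act (src H a) r * r';
  ydm_ract : forall a (r r' : R), ra (r * r') a = r * ra r' a;
  ydm_mid : forall a (r r' : R), ra r a * r' = r * act (src H a) r';
  ydm_rhoM : forall r r' : R,
    rho (r * r') =
    \tsum_(r0, r1 <- rho r) \tsum_(q0, q1 <- rho r') (r0 * q0) ⊗ (q1 * r1);
  ydm_rho1 : rho 1 = (1 : R) ⊗ (1 : U)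
}.

Definition braided_commutative (R : kalgType k) (act : U -> R -> R)
    (ra : R -> A -> R) (rho : R -> tensor ra lsrc) : Prop :=
  forall r r' : R, r * r' = \tsum_(q0, q1 <- rho r') q0 * act q1 r.

Section Smash.

Variables (R : kalgType k) (act : U -> R -> R) (ra : R -> A -> R).
Variable rho : R -> tensor ra lsrc.

Definition smash_mul (x y : tensor ra lsrc) : tensor ra lsrc :=
  \tsum_(r, u <- x) \tsum_(r', u' <- y) \tsum_(u1, u2 <- comul H u)
    (r * act u1 r') ⊗ (u2 * u').

Definition smash_src (r : R) : tensor ra lsrc := r ⊗ (1 : U).

Definition smash_comul (x : tensor ra lsrc) :
    tensor (fun y r => smash_mul (rho r) y)
           (fun r y => smash_mul (smash_src r) y) :=
  \tsum_(r, u <- x) \tsum_(u1, u2 <- comul H u) (r ⊗ u1) ⊗ ((1 : R) ⊗ u2).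

Definition smash_counit (x : tensor ra lsrc) : R :=
  \tsum_(r, u <- x) ra r (counit H u).

(* R # U.  The formulas do not depend on representatives once R is a monoid   *)
(* in the category of Yetter-Drinfeld modules.                                *)
Definition smash : bialgebroid_data k :=
  @BialgebroidData k R (tensor ra lsrc)
    smash_mul ((1 : R) ⊗ (1 : U)) smash_src rho smash_comul smash_counit.

End Smash.

End YetterDrinfeld.

Definition action_left_bialgebroid {k : comPzRingType} {B U : kalgType k}
    (H : left_bialgebroid B U) : Prop :=
  exists (A W : kalgType k) (K : left_bialgebroid A W) (R : kalgType k)
    (act : W -> R -> R) (ra : R -> A -> R) (rho : R -> tensor ra (lsrc K)),
    [/\ yd_monoid act rho, braided_commutative act rho &
        exists F f, @bialgebroid_iso k (smash act rho) H F f].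

Section Conditions.

Context {k : comPzRingType} {A W B U : kalgType k}.
Variables (K : left_bialgebroid A W) (H : left_bialgebroid B U).

(* B_f *)
Definition base_ract (f : A -> B) (b : B) (a : A) : B := b * f a.

(* U_{◁ f} *)
Definition total_ract (f : A -> B) (u : U) (a : A) : U := tgt H (f a) * u.

Record action_conditions (F : W -> U) (f : A -> B)
    (rho : U -> tensor (total_ract f) (lsrc K)) : Prop := ActionConditions {
  ac_morphism : @bialgebroid_morphism k K H F f;
  ac_comodule : right_comodule rho;
  ac_linear : forall b (u : U),
    rho (src H b * u) = \tsum_(u0, u1 <- rho u) (src H b * u0) ⊗ u1;
  ac_comul : forall u,
    \tsum_(u0, u1 <- rho u) u0 ⊗ F u1 = comul H u;
  ac_colinear : forall w,
    rho (F w) = \tsum_(w1, w2 <- comul K w) F w1 ⊗ w2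
}.

End Conditions.

(* Main.v *)
From HB Require Import structures.
Require Import Defs.
From mathcomp Require Import all_boot all_algebra.

Set Implicit Arguments.
Unset Strict Implicit.
Unset Printing Implicit Defensive.

Import GRing.Theory.
Local Open Scope ring_scope.

(* If U is R # W via (G, g), put F w = G (1 # w) and f a = g (1 . a),         *)
(* and let rho be the transport of r # w |-> (r # w_(1)) (x) w_(2).           *)
(* Conversely, rho (s b F w) = s b F w_(1) (x) w_(2) makes xi and             *)
(* eta u = counit u_[0] (x) u_[1] mutually inverse.  On B take the action     *)
(* w . b = counit (F w s b) and the coaction eta (t b).  Since xi is          *)
(* injective, an identity in B (x)_A W may be checked in U, where every axiom *)
(* but coassociativity follows from the identities                            *)
(*   F w s b = s (w_(1) . b) F w_(2)  and  F w t b = t (w_(2) . b) F w_(1).   *)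
(* Coassociativity is checked in U (x)_A W, which embeds in U (x)_B U by      *)
(* u (x) w |-> u (x) F w; this embedding takes rho to the coproduct of U, and *)
(* the coproduct of t b is 1 (x) t b.                                         *)

(** The conditions say that [U] is induced from [W] along [f]. By colinearity of [F] and left
    [B]-linearity, [rho] sends [s b F w] to [s b F w_(1) (x) w_(2)]; the counit on the first leg
    then returns [b (x) w] by the counit law of [W] ([xiK]). Conversely, [F] on the second leg of
    [rho] gives the coproduct of [U], so [etaK] is the left counit law of [U].

    Bijectivity of [xi] leaves no freedom on [B]: the target of [B # W] is the coaction and must go
    to [t], and the product [(1 # w)(b # 1)] must go to [F w s b], whose counit is [w . b]. The
    axioms become identities in [U]. Yetter-Drinfeld compatibility expands [F w t b] in two ways
    ([mulF_src], [mulF_tgt]); multiplicativity of the coaction is antimultiplicativity of [t];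
    braided commutativity evaluates [counit (t b' s b)] in two ways; coassociativity expands
    [rho (t b)] in two ways ([base_coact_coassoc]). Since [xi] is multiplicative ([xi_mul]), it is
    an isomorphism of bialgebroids ([xi_iso]).

    In the other direction [R # W] coacts through the coproduct of [W] on its second factor, and
    [w |-> 1 # w] turns this coaction into the coproduct of [R # W]; [smash_conditions] carries it
    over to [U].

    Throughout, [tsum] is a finite sum over a representative. It has a known value on a pure tensor
    only when the summand is balanced, which is what the many [_balanced] lemmas supply. *)

Section LinearMaps.

Context {k : comPzRingType} {V V' : lmodType k}.

Lemma linear_idfun : linear (fun v : V => v).
Proof. by []. Qed.

Lemma linear_compose (V'' : lmodType k) (h : V' -> V'') (f : V -> V') :
  linear h -> linear f -> linear (fun v => h (f v)).
Proof. by move=> hl fl c x y; rewrite fl hl. Qed.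

Lemma linear_kmull (A : kalgType k) (x : A) (f : V -> A) :
  linear f -> linear (fun v => f v * x).
Proof. by move=> fl c u v; rewrite fl mulrDl kscalerAl. Qed.

Lemma linear_kmulr (A : kalgType k) (x : A) (f : V -> A) :
  linear f -> linear (fun v => x * f v).
Proof. by move=> fl c u v; rewrite fl mulrDr kscalerAr. Qed.

Lemma linear_inverse (h : V -> V') (h' : V' -> V) :
  linear h -> cancel h h' -> cancel h' h -> linear h'.
Proof. by move=> hl hK h'K c x y; rewrite -{1}[x]h'K -{1}[y]h'K -hl hK. Qed.

End LinearMaps.

(** * Sweedler calculus for sums over representatives of tensors *)

Section TensorCalculus.

Context {k : comPzRingType} {A : Type} {M N : lmodType k}.
Context {ra : M -> A -> M} {la : A -> N -> N}.
Implicit Types (V : lmodType k) (z : tensor ra la).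

Lemma eq_tsum (V : nmodType) z (g g' : M -> N -> V) :
  (forall m n, g m n = g' m n) -> tsum z g = tsum z g'.
Proof. by move=> gg'; apply: eq_bigr => p _. Qed.

Lemma linear_tensl V (f : V -> M) (n : N) :
  linear f -> linear (fun v => f v ⊗ n : tensor ra la).
Proof. by move=> fl c x y; rewrite fl; case: (tens_balanced ra la) => ->. Qed.

Lemma linear_tensr V (f : V -> N) (m : M) :
  linear f -> linear (fun v => m ⊗ f v : tensor ra la).
Proof. by move=> fl c x y; rewrite fl; case: (tens_balanced ra la) => _ ->. Qed.

Lemma tens_mid (m : M) (a : A) (n : N) :
  ra m a ⊗ n = (m ⊗ la a n : tensor ra la).
Proof. by case: (tens_balanced ra la). Qed.

Lemma linear_tsum V V' z (g : V -> M -> N -> V') :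
  (forall m n, linear (fun v => g v m n)) -> linear (fun v => tsum z (g v)).
Proof.
move=> gl c x y; rewrite /tsum /fsum scaler_sumr -big_split /=.
by apply: eq_bigr => p _; rewrite gl.
Qed.

Lemma linear_tsum_arg V V' (f : V -> tensor ra la) (g : M -> N -> V') :
  linear f -> balanced ra la g -> linear (fun v => tsum (f v) g).
Proof. by move=> fl gb c x y; rewrite fl tsum_linear. Qed.

(** [tsum] is a finite sum over the chosen representative, so a linear map passes through it even
    when [g] is not balanced. *)
Lemma linear_tsum_morph V V' (h : V -> V') z (g : M -> N -> V) :
  linear h -> h (tsum z g) = tsum z (fun m n => h (g m n)).
Proof.
move=> hl; pose hL := GRing.isLinear.Build k V V' *:%R h hl.
pose h' : {linear V -> V'} := HB.pack h hL.
exact: (raddf_sum h').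
Qed.

(** Here [h] has to be balanced: this is what makes [tsum^~ h] linear on the tensor product. *)
Lemma tsum_comp (M' N' : lmodType k) (A' : Type) (ra' : M' -> A' -> M')
    (la' : A' -> N' -> N') V z (g : M -> N -> tensor ra' la')
    (h : M' -> N' -> V) :
  balanced ra' la' h ->
  tsum (tsum z g) h = tsum z (fun m n => tsum (g m n) h).
Proof.
by move=> hb; apply: (linear_tsum_morph (h := tsum^~ h)); apply: tsum_linear.
Qed.

Lemma linear_tensor_ext V (h h' : tensor ra la -> V) :
  linear h -> linear h' -> (forall m n, h (m ⊗ n) = h' (m ⊗ n)) -> h =1 h'.
Proof.
move=> hl h'l hh z; rewrite -[z]tsum_tens !linear_tsum_morph //.
exact: eq_tsum.
Qed.

Lemma tsum_exchange (M' N' : lmodType k) (A' : Type) (ra' : M' -> A' -> M')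
    (la' : A' -> N' -> N') (V : nmodType) z (z' : tensor ra' la')
    (g : M -> N -> M' -> N' -> V) :
  tsum z (fun m n => tsum z' (g m n)) =
  tsum z' (fun m' n' => tsum z (fun m n => g m n m' n')).
Proof. exact: exchange_big. Qed.

End TensorCalculus.

Section BialgebroidLinear.

Context {k : comPzRingType} {A U : kalgType k} (H : left_bialgebroid A U).
Implicit Types (V : lmodType k).

Lemma linear_src V (f : V -> A) : linear f -> linear (fun v => src H (f v)).
Proof. by move=> fl; apply: linear_compose (src_linear H) fl. Qed.
Lemma linear_tgt V (f : V -> A) : linear f -> linear (fun v => tgt H (f v)).
Proof. by move=> fl; apply: linear_compose (tgt_linear H) fl. Qed.
Lemma linear_comul V (f : V -> U) : linear f -> linear (fun v => comul H (f v)).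
Proof. by move=> fl; apply: linear_compose (comul_linear H) fl. Qed.
Lemma linear_counit V (f : V -> U) :
  linear f -> linear (fun v => counit H (f v)).
Proof. by move=> fl; apply: linear_compose (counit_linear H) fl. Qed.

End BialgebroidLinear.

(** A hook: later sections rebind it so that [lin] also knows their own linear maps. The
    balancedness goals of [lin] are closed by [done], which is why such facts are put into the
    context beforehand. *)
Ltac lin_extra := fail.
Ltac lin := intros; cbn beta;
  solve [assumption | exact: linear_idfun
  | apply: linear_tensl; lin | apply: linear_tensr; lin
  | apply: linear_kmull; lin | apply: linear_kmulr; lin
  | apply: linear_tsum; lin | apply: linear_tsum_arg; [lin | done]
  | apply: linear_src; lin | apply: linear_tgt; lin
  | apply: linear_comul; lin | apply: linear_counit; lin
  | lin_extra; lin].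

(** * Coproduct and counit against source and target *)

Section Bialgebroid.

Context {k : comPzRingType} {A U : kalgType k} (H : left_bialgebroid A U).

Lemma counit_srcl a u : counit H (src H a * u) = a * counit H u.
Proof. by have := counit_bimod H a 1 u; rewrite tgt1 !mulr1. Qed.

Lemma counit_tgtl a u : counit H (tgt H a * u) = counit H u * a.
Proof. by have := counit_bimod H 1 a u; rewrite src1 !mul1r. Qed.

Lemma counit_srcE a : counit H (src H a) = a.
Proof. by rewrite -[src H a]mulr1 counit_srcl counit1 mulr1. Qed.

Lemma counit_tgtE a : counit H (tgt H a) = a.
Proof. by rewrite -[tgt H a]mulr1 counit_tgtl counit1 mul1r. Qed.

Lemma counitl_balanced :
  balanced (fun u a => tgt H a * u) (fun a u => src H a * u)
    (fun u v => src H (counit H u) * v).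
Proof.
split; [lin | lin |].
by move=> u a v; rewrite counit_tgtl srcM mulrA.
Qed.

Lemma counitr_balanced :
  balanced (fun u a => tgt H a * u) (fun a u => src H a * u)
    (fun u v => tgt H (counit H v) * u).
Proof.
split; [lin | lin |].
by move=> u a v; rewrite counit_srcl tgtM mulrA.
Qed.

Lemma src_factor_balanced x y :
  balanced (fun u a => tgt H a * u) (fun a u => src H a * u)
    (fun u1 u2 => src H x * u1 ⊗ (tgt H y * u2) :
       tensor (fun u a => tgt H a * u) (fun a u => src H a * u)).
Proof.
split; [lin | lin |].
move=> u a v; rewrite mulrA src_tgtC -mulrA tens_mid.
by rewrite !mulrA src_tgtC.
Qed.

Lemma comul_srcl a u :
  comul H (src H a * u) = \tsum_(u1, u2 <- comul H u) src H a * u1 ⊗ u2.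
Proof.
have := comul_bimod H a 1 u; rewrite tgt1 mulr1 => ->.
by apply: eq_tsum => u1 u2; rewrite mul1r.
Qed.

Lemma comul_tgtl a u :
  comul H (tgt H a * u) = \tsum_(u1, u2 <- comul H u) u1 ⊗ (tgt H a * u2).
Proof.
have := comul_bimod H 1 a u; rewrite src1 mul1r => ->.
by apply: eq_tsum => u1 u2; rewrite mul1r.
Qed.

Lemma comul_srcE a : comul H (src H a) = src H a ⊗ (1 : U).
Proof.
have := comul_bimod H a 1 1; rewrite tgt1 !mulr1 comul1.
by rewrite tsumE; [rewrite mulr1 mul1r |
  have := src_factor_balanced a 1; rewrite tgt1].
Qed.

Lemma comul_tgtE a : comul H (tgt H a) = (1 : U) ⊗ tgt H a.
Proof.
have := comul_bimod H 1 a 1; rewrite src1 mulr1 mul1r comul1.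
by rewrite tsumE; [rewrite !mulr1 |
  have := src_factor_balanced 1 a; rewrite src1].
Qed.

Lemma mul_right_balanced v1 v2 :
  balanced (fun u a => tgt H a * u) (fun a u => src H a * u)
    (fun u1 u2 => u1 * v1 ⊗ (u2 * v2) :
       tensor (fun u a => tgt H a * u) (fun a u => src H a * u)).
Proof.
split; [lin | lin |].
by move=> u a v; rewrite -mulrA tens_mid mulrA.
Qed.

(* The summand alone is not balanced in (v1, v2): the sum over comul u is,    *)
(* because comul u lies in the Takeuchi subspace.                             *)
Lemma mul_left_balanced u :
  balanced (fun u a => tgt H a * u) (fun a u => src H a * u)
    (fun v1 v2 => \tsum_(u1, u2 <- comul H u) u1 * v1 ⊗ (u2 * v2) :
       tensor (fun u a => tgt H a * u) (fun a u => src H a * u)).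
Proof.
split; [lin | lin |].
move=> v1 a v2.
transitivity (tsum (\tsum_(u1, u2 <- comul H u)
      (u1 * tgt H a ⊗ u2 : tensor (fun u a => tgt H a * u)
                                (fun a u => src H a * u)))
   (fun u1 u2 => u1 * v1 ⊗ (u2 * v2) :
       tensor (fun u a => tgt H a * u) (fun a u => src H a * u))).
  rewrite tsum_comp; last exact: mul_right_balanced.
  apply: eq_tsum => u1 u2.
  by rewrite tsumE; [rewrite mulrA | exact: mul_right_balanced].
rewrite comul_takeuchi tsum_comp; last exact: mul_right_balanced.
apply: eq_tsum => u1 u2.
by rewrite tsumE; [rewrite mulrA | exact: mul_right_balanced].
Qed.

(** The sum over [comul (src a)] is brought outside first, because the summand becomes balanced in
    that tensor only after summation over [comul u]. *)
Lemma comul_mul_src u a :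
  comul H (u * src H a) = \tsum_(u1, u2 <- comul H u) u1 * src H a ⊗ u2.
Proof.
rewrite comulM tsum_exchange comul_srcE tsumE; last exact: mul_left_balanced.
by apply: eq_tsum => u1 u2; rewrite mulr1.
Qed.

Lemma comul_mul_tgt u a :
  comul H (u * tgt H a) = \tsum_(u1, u2 <- comul H u) u1 ⊗ (u2 * tgt H a).
Proof.
rewrite comulM tsum_exchange comul_tgtE tsumE; last exact: mul_left_balanced.
by apply: eq_tsum => u1 u2; rewrite mulr1.
Qed.

End Bialgebroid.

(** * Maps out of [U (x)_A W] *)

Section Balanced.

Context {k : comPzRingType} {A W B U : kalgType k}.
Context {K : left_bialgebroid A W} {H : left_bialgebroid B U}.
Context {F : W -> U} {f : A -> B}.

Let UW := tensor (total_ract H f) (lsrc K).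
Let UU := tensor (fun (u : U) b => tgt H b * u) (fun b (u : U) => src H b * u).

Lemma src_tens_balanced b :
  balanced (total_ract H f) (lsrc K) (fun u w => src H b * u ⊗ w : UW).
Proof.
split; [lin | lin |].
by move=> u a w; rewrite /total_ract mulrA src_tgtC -mulrA -tens_mid.
Qed.

(** Well-definedness of [U (x)_B F]: since [F (s a) = s (f a)], a scalar [a] of [A] crosses the
    tensor sign as the scalar [f a] of [B]. *)
Lemma tens_morphism_balanced : @bialgebroid_morphism k K H F f ->
  balanced (total_ract H f) (lsrc K) (fun u w => u ⊗ F w : UU).
Proof.
move=> morF; split=> [w|u|u a w]; first lin.
  by apply: linear_tensr; exact: bmor_linear morF.
have /= -> := bmorM morF; have /= -> := bmor_src morF.
by rewrite tens_mid.
Qed.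

End Balanced.

(** * From the conditions to the Yetter-Drinfeld structure on [B] *)

Section FromConditions.

Context {k : comPzRingType} {A W B U : kalgType k}.
Context {K : left_bialgebroid A W} (H : left_bialgebroid B U).
Context (F : W -> U) (f : A -> B).
Context (rho : U -> tensor (total_ract H f) (lsrc K)).
Hypothesis cond : action_conditions F rho.

Let morphF : @bialgebroid_morphism k K H F f := ac_morphism cond.
Let comodU : right_comodule rho := ac_comodule cond.

Let F1 : F 1 = 1 := bmor1 morphF.
Let FM x y : F (x * y) = F x * F y := bmorM morphF x y.
Let f1 : f 1 = 1 := bmor_base1 morphF.
Let fM a b : f (a * b) = f a * f b := bmor_baseM morphF a b.
Let F_src a : F (src K a) = src H (f a) := bmor_src morphF a.
Let F_tgt a : F (tgt K a) = tgt H (f a) := bmor_tgt morphF a.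
Let F_counit w : counit H (F w) = f (counit K w) := bmor_counit morphF w.
Let F_comul w :
  comul H (F w) = \tsum_(w1, w2 <- comul K w) F w1 ⊗ F w2 :=
  bmor_comul morphF w.

Let linear_F (V : lmodType k) (g : V -> W) :
  linear g -> linear (fun v => F (g v)).
Proof. by move=> gl; apply: linear_compose (bmor_linear morphF) gl. Qed.

Let linear_f (V : lmodType k) (g : V -> A) :
  linear g -> linear (fun v => f (g v)).
Proof. by move=> gl; apply: linear_compose (bmor_base_linear morphF) gl. Qed.

Let linear_rho (V : lmodType k) (g : V -> U) :
  linear g -> linear (fun v => rho (g v)).
Proof. by move=> gl; apply: linear_compose (rcom_linear comodU) gl. Qed.

Ltac lin_extra ::=
  first [apply: linear_F | apply: linear_f | apply: linear_rho].

Let BW := tensor (base_ract f) (lsrc K).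
Let UW := tensor (total_ract H f) (lsrc K).
Let UU := tensor (fun (u : U) b => tgt H b * u) (fun b (u : U) => src H b * u).

Definition xi (x : BW) : U := \tsum_(b, w <- x) src H b * F w.
Definition eta (u : U) : BW := \tsum_(u0, u1 <- rho u) counit H u0 ⊗ u1.

Lemma xi_balanced :
  balanced (base_ract f) (lsrc K) (fun b w => src H b * F w).
Proof.
split; [lin | lin |].
by move=> b a w; rewrite /base_ract /lsrc srcM FM F_src mulrA.
Qed.

Lemma xi_linear : linear xi.
Proof. exact: tsum_linear xi_balanced. Qed.

Lemma xiE b w : xi (b ⊗ w) = src H b * F w.
Proof. exact: tsumE xi_balanced. Qed.

Lemma xi_tsum (M N : lmodType k) (X : Type) (ra : M -> X -> M)
    (la : X -> N -> N) (z : tensor ra la) (g : M -> N -> BW) :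
  xi (tsum z g) = tsum z (fun m n => xi (g m n)).
Proof. exact: linear_tsum_morph xi_linear. Qed.

Lemma eta_balanced :
  balanced (total_ract H f) (lsrc K) (fun u w => counit H u ⊗ w : BW).
Proof.
split; [lin | lin |].
by move=> u a w; rewrite /total_ract counit_tgtl -tens_mid.
Qed.

Lemma eta_linear : linear eta.
Proof. rewrite /eta; have := eta_balanced; lin. Qed.

Lemma rho_srcF b w :
  rho (src H b * F w) =
  \tsum_(w1, w2 <- comul K w) src H b * F w1 ⊗ w2.
Proof.
rewrite (ac_linear cond) (ac_colinear cond) tsum_comp;
  last exact: src_tens_balanced.
by apply: eq_tsum => w1 w2; rewrite tsumE //; apply: src_tens_balanced.
Qed.

(** After [rho_srcF], the counit of [s b F w_(1)] is [b f (counit w_(1))]; the scalar crosses to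
    [w_(2)], where the left counit law of [W] absorbs it. *)
Lemma xiK : cancel xi eta.
Proof.
apply: linear_tensor_ext => [||b w].
- exact: linear_compose eta_linear xi_linear.
- exact: linear_idfun.
rewrite xiE /eta rho_srcF tsum_comp; last exact: eta_balanced.
transitivity (\tsum_(w1, w2 <- comul K w)
    (b ⊗ (src K (counit K w1) * w2) : BW)).
  apply: eq_tsum => w1 w2; rewrite tsumE; last exact: eta_balanced.
  by rewrite counit_srcl F_counit -[b * _]/(base_ract f b _) tens_mid.
rewrite -[w in RHS](comul_counitl K) [RHS]linear_tsum_morph //; lin.
Qed.

(** The composite is the sum of [s (counit u_[0]) F u_[1]], which by [ac_comul] is the left counit
    law of [U]. *)
Lemma etaK : cancel eta xi.
Proof.
move=> u; rewrite /eta xi_tsum.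
rewrite -[RHS](comul_counitl H) -(ac_comul cond) tsum_comp;
  last exact: counitl_balanced.
apply: eq_tsum => u0 u1; rewrite xiE tsumE //; exact: counitl_balanced.
Qed.

Lemma xi_inj : injective xi.
Proof. exact: can_inj xiK. Qed.

(** The canonical action of a left bialgebroid on its base, restricted along [F]. *)
Definition base_act (w : W) (b : B) : B := counit H (F w * src H b).
(** The only choice for which [xi] carries the target of [B # W] to that of [U]. *)
Definition base_coact (b : B) : BW := eta (tgt H b).

Lemma xi_base_coact b : xi (base_coact b) = tgt H b.
Proof. exact: etaK. Qed.

Lemma base_coactE b :
  \tsum_(b0, b1 <- base_coact b) src H b0 * F b1 = tgt H b.
Proof. exact: xi_base_coact. Qed.

Lemma comul_F_src w b :
  comul H (F w * src H b) =
  \tsum_(w1, w2 <- comul K w) F w1 * src H b ⊗ F w2.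
Proof.
have := mul_right_balanced H (src H b) 1 => bal.
transitivity (\tsum_(u1, u2 <- comul H (F w)) (u1 * src H b ⊗ (u2 * 1) : UU)).
  by rewrite comul_mul_src; apply: eq_tsum => u1 u2; rewrite mulr1.
rewrite F_comul tsum_comp //; apply: eq_tsum => w1 w2.
by rewrite tsumE // mulr1.
Qed.

Lemma comul_F_tgt w b :
  comul H (F w * tgt H b) =
  \tsum_(w1, w2 <- comul K w) F w1 ⊗ (F w2 * tgt H b).
Proof.
have := mul_right_balanced H 1 (tgt H b) => bal.
transitivity (\tsum_(u1, u2 <- comul H (F w)) (u1 * 1 ⊗ (u2 * tgt H b) : UU)).
  by rewrite comul_mul_tgt; apply: eq_tsum => u1 u2; rewrite mulr1.
rewrite F_comul tsum_comp //; apply: eq_tsum => w1 w2.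
by rewrite tsumE // mulr1.
Qed.

(** The left counit law of [U] at [F w s b]: the factor [s b] stays on the first leg of the
    coproduct, so the counit there yields the action. For [mulF_tgt], the factor [t b] stays on the
    second leg and the right counit law applies. *)
Lemma mulF_src w b :
  \tsum_(w1, w2 <- comul K w) src H (base_act w1 b) * F w2 = F w * src H b.
Proof.
rewrite -[RHS](comul_counitl H) comul_F_src.
rewrite tsum_comp; last exact: counitl_balanced.
by apply: eq_tsum => w1 w2; rewrite tsumE //; apply: counitl_balanced.
Qed.

Lemma mulF_tgt w b :
  \tsum_(w1, w2 <- comul K w) tgt H (base_act w2 b) * F w1 = F w * tgt H b.
Proof.
rewrite -[RHS](comul_counitr H) comul_F_tgt.
rewrite tsum_comp; last exact: counitr_balanced.
apply: eq_tsum => w1 w2; rewrite tsumE; last exact: counitr_balanced.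
(* The counit does not distinguish right multiplication by [s b] from right multiplication by
   [t b]. *)
by rewrite /base_act (counit_tgt H _ (src H b)) counit_srcE.
Qed.

Lemma xi_mull (b : B) (x : BW) :
  xi (\tsum_(b', w <- x) ((b * b') ⊗ w : BW)) = src H b * xi x.
Proof.
have lin_b : linear (fun u : U => src H b * u) by lin.
rewrite xi_tsum {2}/xi (linear_tsum_morph _ _ lin_b).
by apply: eq_tsum => b' w; rewrite xiE srcM mulrA.
Qed.

Lemma xi_ract (x : BW) (a : A) :
  xi (tens_ract (tgt K) x a) = tgt H (f a) * xi x.
Proof.
have lin_a : linear (fun u : U => tgt H (f a) * u) by lin.
rewrite /tens_ract xi_tsum {2}/xi (linear_tsum_morph _ _ lin_a).
by apply: eq_tsum => b w; rewrite xiE FM F_tgt !mulrA src_tgtC.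
Qed.

Lemma eta_src (b : B) (u : U) :
  eta (src H b * u) = \tsum_(b', w <- eta u) ((b * b') ⊗ w : BW).
Proof. by apply: xi_inj; rewrite etaK xi_mull etaK. Qed.

Lemma eta_ract u a : eta (total_ract H f u a) = tens_ract (tgt K) (eta u) a.
Proof. by apply: xi_inj; rewrite etaK xi_ract etaK. Qed.

Let linear_eta (V : lmodType k) (g : V -> U) :
  linear g -> linear (fun v => eta (g v)).
Proof. by move=> gl; apply: linear_compose eta_linear gl. Qed.

Let linear_xi (V : lmodType k) (g : V -> BW) :
  linear g -> linear (fun v => xi (g v)).
Proof. by move=> gl; apply: linear_compose xi_linear gl. Qed.

Ltac lin_extra ::= first [apply: linear_F | apply: linear_f | apply: linear_rho
  | apply: linear_eta | apply: linear_xi].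

Lemma tgt_tens_balanced u :
  balanced (base_ract f) (lsrc K) (fun b w => tgt H b * u ⊗ w : UW).
Proof.
split; [lin | lin |].
by move=> b a w; rewrite /base_ract tgtM -mulrA -tens_mid.
Qed.

(* Inverse of u (x)_A w |-> u (x)_B F w; hence rho is determined by comul H.  *)
Definition unF (y : UU) : UW :=
  \tsum_(u, v <- y) \tsum_(b, w <- eta v) tgt H b * u ⊗ w.

Lemma unF_balanced :
  balanced (fun u a => tgt H a * u) (fun a u => src H a * u)
    (fun u v => \tsum_(b, w <- eta v) tgt H b * u ⊗ w : UW).
Proof.
split=> [|u|u b v]; first lin.
  have := tgt_tens_balanced u; lin.
rewrite eta_src [RHS]tsum_comp; last exact: tgt_tens_balanced.
apply: eq_tsum => b' w; rewrite tsumE; last exact: tgt_tens_balanced.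
by rewrite tgtM mulrA.
Qed.

Lemma unF_comul u : unF (comul H u) = rho u.
Proof.
rewrite -(ac_comul cond) /unF tsum_comp; last exact: unF_balanced.
rewrite -[RHS]tsum_tens; apply: eq_tsum => u0 u1.
rewrite tsumE; last exact: unF_balanced.
have -> : eta (F u1) = (1 : B) ⊗ u1.
  by apply: xi_inj; rewrite etaK xiE src1 mul1r.
by rewrite tsumE ?tgt1 ?mul1r //; apply: tgt_tens_balanced.
Qed.

(** [rho] is recovered from the coproduct by [unF], and the coproduct of [t b] is [1 (x) t b]. *)
Lemma rho_tgt b :
  rho (tgt H b) = \tsum_(b0, b1 <- base_coact b) tgt H b0 ⊗ b1.
Proof.
rewrite -unF_comul comul_tgtE /unF tsumE; last exact: unF_balanced.
by apply: eq_tsum => b0 b1; rewrite mulr1.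
Qed.

Let BWW := tensor (@tens_ract _ _ _ _ (src K) (tgt K) (base_ract f)) (lsrc K).

Lemma xi_tens_balanced :
  balanced (@tens_ract _ _ _ _ (src K) (tgt K) (base_ract f)) (lsrc K)
    (fun x w => xi x ⊗ w : UW).
Proof.
split; [lin | lin |].
by move=> x a w; rewrite xi_ract -[_ * xi x]/(total_ract H f _ a) tens_mid.
Qed.

Lemma eta_tens_balanced :
  balanced (total_ract H f) (lsrc K) (fun u w => eta u ⊗ w : BWW).
Proof.
split; [lin | lin |].
by move=> u a w; rewrite eta_ract tens_mid.
Qed.

(** No flatness is involved: [eta] is right [A]-linear, so [eta (x) id] is a well-defined
    retraction. *)
Lemma xi_tens_inj : injective (fun z : BWW => \tsum_(x, w <- z) xi x ⊗ w : UW).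
Proof.
apply: (can_inj (g := fun y : UW => \tsum_(u, w <- y) eta u ⊗ w)) => z.
rewrite tsum_comp; last exact: eta_tens_balanced.
rewrite -[RHS]tsum_tens; apply: eq_tsum => x w.
by rewrite tsumE ?xiK //; apply: eta_tens_balanced.
Qed.

(** Under [xi (x) id] both sides become [rho (t b)]: the left one by [rho_tgt], the right one by
    writing [t b] as the sum of [s b0 F b1] and using [rho_srcF]. *)
Lemma base_coact_coassoc b :
  \tsum_(b0, b1 <- base_coact b) (base_coact b0 ⊗ b1 : BWW) =
  \tsum_(b0, b1 <- base_coact b) \tsum_(w1, w2 <- comul K b1) (b0 ⊗ w1) ⊗ w2.
Proof.
apply: xi_tens_inj; rewrite [LHS]tsum_comp; last exact: xi_tens_balanced.
rewrite [RHS]tsum_comp; last exact: xi_tens_balanced.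
transitivity (rho (tgt H b)).
  rewrite rho_tgt; apply: eq_tsum => b0 b1.
  by rewrite tsumE ?xi_base_coact //; apply: xi_tens_balanced.
rewrite -base_coactE (linear_tsum_morph _ _ (rcom_linear comodU)).
apply: eq_tsum => b0 b1; rewrite rho_srcF tsum_comp;
  last exact: xi_tens_balanced.
apply: eq_tsum => w1 w2.
by rewrite tsumE ?xiE //; apply: xi_tens_balanced.
Qed.

Let base_coact_linear : linear base_coact.
Proof. rewrite /base_coact; lin. Qed.

Lemma base_comodule : right_comodule base_coact.
Proof.
split=> [a|b|b|b a a'|||b|b].
- rewrite /base_ract; lin.
- rewrite /base_ract; lin.
- by rewrite /base_ract f1 mulr1.
- by rewrite /base_ract fM mulrA.
- exact: base_coact_linear.
- move=> b a; apply: xi_inj.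
  rewrite -[RHS]/(xi (tens_ract (tgt K) (base_coact b) a)) xi_ract.
  by rewrite !xi_base_coact tgtM.
- exact: base_coact_coassoc.
(* Counitality is the identity [counit (t b) = b] with [t b] expanded through the coaction. *)
rewrite -[RHS](counit_tgtE H) -base_coactE.
rewrite (linear_tsum_morph _ _ (counit_linear H)).
by apply: eq_tsum => b0 b1; rewrite counit_srcl F_counit.
Qed.

Lemma base_coactE_right b y :
  \tsum_(b0, b1 <- base_coact b) src H b0 * (F b1 * y) = tgt H b * y.
Proof.
have lin_y : linear (fun u : U => u * y) by lin.
rewrite -base_coactE (linear_tsum_morph _ _ lin_y).
by apply: eq_tsum => b0 b1; rewrite mulrA.
Qed.

Lemma base_act_src a b : base_act (src K a) b = f a * b.
Proof. by rewrite /base_act F_src -srcM counit_srcE. Qed.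

Lemma base_act1 w : base_act w 1 = f (counit K w).
Proof. by rewrite /base_act src1 mulr1 F_counit. Qed.

Lemma base_left_module : left_module base_act.
Proof.
split=> [b|w|b|v w b].
- rewrite /base_act; lin.
- rewrite /base_act; lin.
- by rewrite /base_act F1 mul1r counit_srcE.
by rewrite /base_act FM -mulrA counit_src.
Qed.

Lemma base_yd_module : yd_module base_act base_coact.
Proof.
split=> [||a b|a b|w b].
- exact: base_left_module.
- exact: base_comodule.
- rewrite base_act_src -[LHS]mulr1.
  (* This counit is [f a * b] by [B]-bilinearity; expanding [t b] through the coaction gives the
     induced left action. *)
  transitivity (counit H (tgt H b * src H (f a))).
    by rewrite counit_tgtl counit_srcE mulr1.
  rewrite -base_coactE_right (linear_tsum_morph _ _ (counit_linear H)).
  apply: eq_tsum => b0 b1.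
  by rewrite counit_srcl /base_ract -F_counit FM F_src.
- by rewrite /base_act F_tgt counit_tgtl counit_srcE.
apply: xi_inj; rewrite !xi_tsum.
(* Both sides of the compatibility are expansions of this element: on the left [t b] is expanded and
   [F w] is moved past the sources, on the right [F w t b] is rewritten by [mulF_tgt] and the
   resulting targets are expanded. *)
transitivity (F w * tgt H b).
  have lin_w : linear (fun u : U => F w * u) by lin.
  under eq_tsum do rewrite xi_tsum.
  rewrite tsum_exchange -base_coactE (linear_tsum_morph _ _ lin_w).
  apply: eq_tsum => b0 b1; rewrite mulrA -mulF_src.
  have lin_b : linear (fun u : U => u * F b1) by lin.
  rewrite (linear_tsum_morph _ _ lin_b).
  by apply: eq_tsum => w1 w2; rewrite xiE FM mulrA.
rewrite -mulF_tgt; apply: eq_tsum => w1 w2.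
rewrite xi_tsum -base_coactE_right; apply: eq_tsum => b0 b1.
by rewrite xiE FM.
Qed.

Lemma base_yd_monoid : yd_monoid base_act base_coact.
Proof.
split=> [|w b b'|w|a b b'|b b' a|a b b'|b b'|].
- exact: base_yd_module.
- rewrite /base_act srcM mulrA -mulF_src.
  have lin_b : linear (fun u : U => counit H (u * src H b')) by lin.
  rewrite (linear_tsum_morph _ _ lin_b).
  by apply: eq_tsum => w1 w2; rewrite -mulrA counit_srcl.
- by rewrite base_act_src base_act1 mulr1.
- by rewrite !base_act_src mulrA.
- by rewrite /base_ract mulrA.
- by rewrite base_act_src mulrA.
(* In [U] the claim concerns [t (b b') = t b' t b]; expanding [t b], sliding [t b'] past the source
   and expanding it too gives the reversed order of the [W]-factors. *)
- apply: xi_inj; rewrite xi_base_coact tgtM xi_tsum.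
  have lin_b' : linear (fun u : U => tgt H b' * u) by lin.
  rewrite -(base_coactE b) (linear_tsum_morph _ _ lin_b').
  apply: eq_tsum => b0 b1; rewrite mulrA -src_tgtC -mulrA -base_coactE_right.
  have lin_b0 : linear (fun u : U => src H b0 * u) by lin.
  rewrite xi_tsum (linear_tsum_morph _ _ lin_b0).
  by apply: eq_tsum => c0 c1; rewrite xiE srcM FM !mulrA.
by apply: xi_inj; rewrite xi_base_coact xiE src1 tgt1 F1 mulr1.
Qed.

(** Two evaluations of [counit (t b' s b)]: by [B]-bilinearity of the counit, and with [t b']
    expanded through the coaction. *)
Lemma base_braided_commutative : braided_commutative base_act base_coact.
Proof.
move=> b b'; transitivity (counit H (tgt H b' * src H b)).
  by rewrite counit_tgtl counit_srcE.
rewrite -base_coactE_right (linear_tsum_morph _ _ (counit_linear H)).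
by apply: eq_tsum => c0 c1; rewrite counit_srcl.
Qed.

(** The smash product encodes the rule [mulF_src] for moving [F w] past [s b']. *)
Lemma xi_mul (x y : BW) : xi (smash_mul base_act x y) = xi x * xi y.
Proof.
have lin_y : linear (fun u : U => u * xi y) by lin.
rewrite {2}/xi (linear_tsum_morph _ _ lin_y) /smash_mul xi_tsum.
apply: eq_tsum => b w.
have lin_x : linear (fun u : U => src H b * F w * u) by lin.
rewrite {2}/xi (linear_tsum_morph _ _ lin_x) xi_tsum.
apply: eq_tsum => b' w'.
have lin_w : linear (fun u : U => src H b * u * F w') by lin.
rewrite mulrA -[_ * F w * _]mulrA -mulF_src.
rewrite (linear_tsum_morph _ _ lin_w) xi_tsum.
by apply: eq_tsum => w1 w2; rewrite xiE srcM FM !mulrA.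
Qed.

Lemma xi_xi_balanced :
  balanced (fun y r => smash_mul base_act (base_coact r) y)
    (fun r y => smash_mul base_act (smash_src K (base_ract f) r) y)
    (fun x y => xi x ⊗ xi y : UU).
Proof.
split; [lin | lin |].
move=> x b y; rewrite !xi_mul xi_base_coact /smash_src xiE F1 mulr1.
by rewrite -tens_mid.
Qed.

Lemma xi_iso : @bialgebroid_iso k (smash base_act base_coact) H xi id.
Proof.
split; last by exists id.
- apply: (@BialgebroidMorphism k (smash base_act base_coact) H xi id) => //=.
  + exact: xi_linear.
  + by rewrite xiE src1 F1 mulr1.
  + exact: xi_mul.
  + by move=> b; rewrite /smash_src xiE F1 mulr1.
  + exact: xi_base_coact.
  + move=> x; rewrite /xi (linear_tsum_morph _ _ (counit_linear H)).
    by apply: eq_tsum => b w; rewrite counit_srcl F_counit.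
  + move=> x; rewrite /smash_comul tsum_comp; last exact: xi_xi_balanced.
    rewrite {1}/xi (linear_tsum_morph _ _ (comul_linear H)).
    apply: eq_tsum => b w; rewrite comul_srcl F_comul.
    have bal := src_factor_balanced H b 1.
    (* The factor [tgt H 1] is inserted to give the summand the form covered by
       [src_factor_balanced]. *)
    transitivity (\tsum_(u1, u2 <- (\tsum_(w1, w2 <- comul K w)
        (F w1 ⊗ F w2 : UU))) (src H b * u1 ⊗ (tgt H 1 * u2) : UU)).
      by apply: eq_tsum => u1 u2; rewrite tgt1 mul1r.
    rewrite tsum_comp // tsum_comp; last exact: xi_xi_balanced.
    apply: eq_tsum => w1 w2; rewrite !tsumE //; last exact: xi_xi_balanced.
    by rewrite !xiE src1 tgt1 !mul1r.
exact: Bijective xiK etaK.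
Qed.

End FromConditions.

(** * The operations of [R # W] on pure tensors *)

Section SmashProduct.

Context {k : comPzRingType} {A W : kalgType k} {K : left_bialgebroid A W}.
Context {R : kalgType k} {act : W -> R -> R} (ra : R -> A -> R).
Context {rho : R -> tensor ra (lsrc K)}.
Hypothesis ydR : yd_monoid act rho.

Let modR : left_module act := yd_left_module (ydm_yd ydR).
Let comodR : right_comodule rho := yd_right_comodule (ydm_yd ydR).
Let act_tgt a r : act (tgt K a) r = ra r a := yd_ract (ydm_yd ydR) a r.
Let RW := tensor ra (lsrc K).

Let linear_actl (V : lmodType k) (g : V -> W) r :
  linear g -> linear (fun v => act (g v) r).
Proof. by move=> gl; apply: linear_compose (lmod_linearl modR r) gl. Qed.

Let linear_actr (V : lmodType k) w (g : V -> R) :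
  linear g -> linear (fun v => act w (g v)).
Proof. by move=> gl; apply: linear_compose (lmod_linearr modR w) gl. Qed.

Let linear_ral (V : lmodType k) (g : V -> R) a :
  linear g -> linear (fun v => ra (g v) a).
Proof. by move=> gl; apply: linear_compose (rcom_linearl comodR a) gl. Qed.

Let linear_rar (V : lmodType k) r (g : V -> A) :
  linear g -> linear (fun v => ra r (g v)).
Proof. by move=> gl; apply: linear_compose (rcom_linearr comodR r) gl. Qed.

Ltac lin_extra ::= first [apply: linear_actl | apply: linear_actr
  | apply: linear_ral | apply: linear_rar].

(** The left action is determined by the coaction, and the coaction fixes [1]. Hence [a |-> ra 1 a]
    is compatible with both [A]-module structures. *)
Lemma act_src1 a : act (src K a) 1 = ra 1 a.
Proof.
rewrite (yd_lact (ydm_yd ydR)) /comodule_lact (ydm_rho1 ydR) tsumE.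
  by rewrite mul1r counit_srcE.
split; [lin | lin |].
by move=> r a' w; rewrite /lsrc -mulrA counit_srcl (rcom_ractM comodR).
Qed.

Lemma rho_ra1 a : rho (ra 1 a) = (1 : R) ⊗ tgt K a.
Proof.
rewrite (rcom_ract comodR) (ydm_rho1 ydR) tsumE ?mulr1 //.
split; [lin | lin |].
by move=> r a' w; rewrite /lsrc mulrA -src_tgtC -mulrA tens_mid.
Qed.

Lemma smash_mul_balanced r r' w' :
  balanced (fun u a => tgt K a * u) (fun a u => src K a * u)
    (fun w1 w2 => (r * act w1 r') ⊗ (w2 * w') : RW).
Proof.
split; [lin | lin |].
move=> w1 a w2; rewrite (lmodM modR) act_tgt -(ydm_ract ydR) tens_mid.
by rewrite /lsrc mulrA.
Qed.

(** Balancedness holds only after summation over [comul w], by the Takeuchi condition. *)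
Lemma smash_mulr_balanced r w :
  balanced ra (lsrc K)
    (fun r' w' => \tsum_(w1, w2 <- comul K w) (r * act w1 r') ⊗ (w2 * w') : RW).
Proof.
split; [lin | lin |].
move=> r' a w'.
have bal := smash_mul_balanced r r' w'.
transitivity (\tsum_(w1, w2 <- (\tsum_(w1, w2 <- comul K w)
      (w1 * tgt K a ⊗ w2 : tensor (fun u a => tgt K a * u)
                                  (fun a u => src K a * u))))
    ((r * act w1 r') ⊗ (w2 * w') : RW)).
  rewrite tsum_comp //; apply: eq_tsum => w1 w2.
  by rewrite tsumE // (lmodM modR) act_tgt.
rewrite comul_takeuchi tsum_comp //; apply: eq_tsum => w1 w2.
by rewrite tsumE // /lsrc mulrA.
Qed.

Lemma smash_mull_balanced r' w' :
  balanced ra (lsrc K)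
    (fun r w => \tsum_(w1, w2 <- comul K w) (r * act w1 r') ⊗ (w2 * w') : RW).
Proof.
split; [lin | |].
  by move=> r; have bal := smash_mul_balanced r r' w'; lin.
move=> r a w; have bal := smash_mul_balanced r r' w'.
rewrite /lsrc comul_srcl tsum_comp //; apply: eq_tsum => w1 w2.
by rewrite tsumE // (lmodM modR) (ydm_mid ydR).
Qed.

Lemma smash_mulE (r : R) (w : W) (r' : R) (w' : W) :
  smash_mul act (r ⊗ w : RW) (r' ⊗ w') =
  \tsum_(w1, w2 <- comul K w) (r * act w1 r') ⊗ (w2 * w').
Proof.
(* The nested sums are evaluated one at a time: the first argument becomes pure while [y] is still
   arbitrary. *)
have smash_mull (y : RW) : \tsum_(q, v <- y) \tsum_(w1, w2 <- comul K w)
    ((r * act w1 q) ⊗ (w2 * v) : RW) = smash_mul act (r ⊗ w : RW) y.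
  rewrite /smash_mul tsumE //; split=> [v|q|q a v].
  - have bal r0 w0 := smash_mulr_balanced r0 w0; apply: linear_tsum => q0 v0.
    by case: (smash_mull_balanced q0 v0).
  - by apply: linear_tsum => q0 v0; case: (smash_mull_balanced q0 v0).
  by apply: eq_tsum => q0 v0; case: (smash_mull_balanced q0 v0).
by rewrite -smash_mull tsumE //; apply: smash_mulr_balanced.
Qed.

Lemma smash_mul_srcE (r r' : R) (w : W) :
  smash_mul act (r ⊗ (1 : W) : RW) (r' ⊗ w) = (r * r') ⊗ w.
Proof.
rewrite smash_mulE comul1 tsumE; last exact: smash_mul_balanced.
by rewrite (lmod1 modR) mul1r.
Qed.

Lemma smash_mul_tgtE (a : A) (r : R) (w : W) :
  smash_mul act ((1 : R) ⊗ tgt K a : RW) (r ⊗ w) = r ⊗ (tgt K a * w).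
Proof.
rewrite smash_mulE comul_tgtE tsumE; last exact: smash_mul_balanced.
by rewrite (lmod1 modR) mul1r.
Qed.

(** The unit axiom turns [w_(1) . 1] into the scalar [counit w_(1)], which crosses to [w_(2)] and is
    absorbed by the left counit law. *)
Lemma smash_mul_1E (w w' : W) :
  smash_mul act ((1 : R) ⊗ w : RW) ((1 : R) ⊗ w') = (1 : R) ⊗ (w * w').
Proof.
rewrite smash_mulE -[w in RHS](comul_counitl K).
have lin_w' : linear (fun w : W => (1 : R) ⊗ (w * w') : RW) by lin.
rewrite [RHS](linear_tsum_morph _ _ lin_w'); apply: eq_tsum => w1 w2.
by rewrite mul1r (ydm_act1 ydR) act_src1 tens_mid /lsrc mulrA.
Qed.

Lemma tens_ra1 (a : A) : ra 1 a ⊗ (1 : W) = ((1 : R) ⊗ src K a : RW).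
Proof. by rewrite tens_mid /lsrc mulr1. Qed.

Lemma smash_counit_balanced :
  balanced ra (lsrc K) (fun r w => ra r (counit K w)).
Proof.
split; [lin | lin |].
by move=> r a w; rewrite /lsrc counit_srcl (rcom_ractM comodR).
Qed.

Lemma smash_counitE (r : R) (w : W) :
  smash_counit (r ⊗ w : RW) = ra r (counit K w).
Proof. by rewrite /smash_counit tsumE //; apply: smash_counit_balanced. Qed.

Let RWRW := tensor (fun y r => smash_mul act (rho r) y)
                   (fun r y => smash_mul act (smash_src K ra r) y).

(** A scalar [a] of [A] crosses the tensor over [R] as the element [ra 1 a], whose target is
    [1 # t a] and whose source is [1 # s a]. *)
Lemma smash_comul_inner_balanced r :
  balanced (fun u a => tgt K a * u) (fun a u => src K a * u)
    (fun w1 w2 => (r ⊗ w1) ⊗ ((1 : R) ⊗ w2) : RWRW).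
Proof.
split; [lin | lin |].
move=> w1 a w2; rewrite -smash_mul_tgtE -rho_ra1 tens_mid.
by rewrite /smash_src tens_ra1 smash_mul_1E.
Qed.

Lemma smash_comul_balanced :
  balanced ra (lsrc K) (fun r w =>
    \tsum_(w1, w2 <- comul K w) (r ⊗ w1) ⊗ ((1 : R) ⊗ w2) : RWRW).
Proof.
split=> [w|r|r a w]; first lin.
  by have bal := smash_comul_inner_balanced r; lin.
have bal := smash_comul_inner_balanced r.
rewrite /lsrc comul_srcl tsum_comp //; apply: eq_tsum => w1 w2.
by rewrite tsumE // tens_mid.
Qed.

Lemma smash_comulE (r : R) (w : W) :
  smash_comul act rho (r ⊗ w) =
  \tsum_(w1, w2 <- comul K w) (r ⊗ w1) ⊗ ((1 : R) ⊗ w2).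
Proof. by rewrite /smash_comul tsumE //; apply: smash_comul_balanced. Qed.

(** * From an isomorphism [R # W -> U] to the conditions *)

Section Isomorphism.

Context {B U : kalgType k} {H : left_bialgebroid B U}.
Context (G : RW -> U) (g : R -> B).
Hypothesis isoG : @bialgebroid_iso k (smash act rho) H G g.

Let morG : @bialgebroid_morphism k (smash act rho) H G g.
Proof. by case: isoG. Qed.

Let G1 : G ((1 : R) ⊗ (1 : W)) = 1 := bmor1 morG.
Let GM x y : G (smash_mul act x y) = G x * G y := bmorM morG x y.
Let G_src r : G (r ⊗ (1 : W)) = src H (g r) := bmor_src morG r.
Let G_tgt r : G (rho r) = tgt H (g r) := bmor_tgt morG r.
Let G_counit x : counit H (G x) = g (smash_counit x) := bmor_counit morG x.
Let G_comul x :
  comul H (G x) = \tsum_(x1, x2 <- smash_comul act rho x) G x1 ⊗ G x2 :=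
  bmor_comul morG x.

Let linear_G (V : lmodType k) (h : V -> RW) :
  linear h -> linear (fun v => G (h v)).
Proof. by move=> hl; apply: linear_compose (bmor_linear morG) hl. Qed.

Let linear_g (V : lmodType k) (h : V -> R) :
  linear h -> linear (fun v => g (h v)).
Proof. by move=> hl; apply: linear_compose (bmor_base_linear morG) hl. Qed.

Ltac lin_extra ::= first [apply: linear_actl | apply: linear_actr
  | apply: linear_ral | apply: linear_rar | apply: linear_G | apply: linear_g].

Definition smash_F (w : W) : U := G ((1 : R) ⊗ w).
Definition smash_f (a : A) : B := g (ra 1 a).

Let UU := tensor (fun (u : U) b => tgt H b * u) (fun b (u : U) => src H b * u).
Let UW := tensor (total_ract H smash_f) (lsrc K).

Lemma G_tgt_mul r a w : G (r ⊗ (tgt K a * w)) = tgt H (smash_f a) * G (r ⊗ w).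
Proof. by rewrite -smash_mul_tgtE -rho_ra1 GM G_tgt. Qed.

Lemma comulG (r : R) (w : W) :
  comul H (G (r ⊗ w)) = \tsum_(w1, w2 <- comul K w) G (r ⊗ w1) ⊗ smash_F w2.
Proof.
have bal : balanced (fun y r => smash_mul act (rho r) y)
    (fun r y => smash_mul act (smash_src K ra r) y)
    (fun x y => G x ⊗ G y : UU).
  split; [lin | lin |].
  by move=> x r' y; rewrite !GM G_tgt /smash_src G_src -tens_mid.
rewrite G_comul smash_comulE tsum_comp //.
by apply: eq_tsum => w1 w2; rewrite tsumE.
Qed.

Lemma smash_morphism : @bialgebroid_morphism k K H smash_F smash_f.
Proof.
apply: (@BialgebroidMorphism k K H) => /=.
- by rewrite /smash_F; lin.
- exact: G1.
- by move=> w w'; rewrite /smash_F -smash_mul_1E GM.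
- by rewrite /smash_f; lin.
- by rewrite /smash_f (rcom_ract1 comodR) (bmor_base1 morG).
(* Multiplicativity is read off the left action, which agrees with the right one on [1]. *)
- move=> a b; rewrite /smash_f -(bmor_baseM morG) -!act_src1 srcM (lmodM modR).
  by rewrite -(ydm_lact ydR) mul1r.
- by move=> a; rewrite /smash_F -tens_ra1 G_src.
- by move=> a; rewrite /smash_F -rho_ra1 G_tgt.
- by move=> w; rewrite G_counit smash_counitE.
by move=> w; rewrite comulG.
Qed.

(** The coaction [id (x) comul K] with its first leg already sent to [U]. The argument stays in
    [R # W], where linear identities are checked on pure tensors. *)
Definition smash_coact (x : RW) : UW :=
  \tsum_(r, w <- x) \tsum_(w1, w2 <- comul K w) G (r ⊗ w1) ⊗ w2.

Lemma smash_coact_inner_balanced r :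
  balanced (fun u a => tgt K a * u) (fun a u => src K a * u)
    (fun w1 w2 => G (r ⊗ w1) ⊗ w2 : UW).
Proof.
split; [lin | lin |].
move=> w1 a w2; rewrite G_tgt_mul.
by rewrite -[_ * G _]/(total_ract H smash_f _ a) tens_mid.
Qed.

Lemma smash_coact_balanced :
  balanced ra (lsrc K) (fun r w =>
    \tsum_(w1, w2 <- comul K w) G (r ⊗ w1) ⊗ w2 : UW).
Proof.
split=> [w|r|r a w]; first lin.
  by have bal := smash_coact_inner_balanced r; lin.
have bal := smash_coact_inner_balanced r.
rewrite /lsrc comul_srcl tsum_comp //; apply: eq_tsum => w1 w2.
by rewrite tsumE // tens_mid.
Qed.

Lemma smash_coact_linear : linear smash_coact.
Proof. exact: tsum_linear smash_coact_balanced. Qed.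

Lemma smash_coactE (r : R) (w : W) :
  smash_coact (r ⊗ w) = \tsum_(w1, w2 <- comul K w) G (r ⊗ w1) ⊗ w2.
Proof. by rewrite /smash_coact tsumE //; apply: smash_coact_balanced. Qed.

Lemma smash_mul_linear y : linear (smash_mul act y : RW -> RW).
Proof.
apply: linear_tsum => r w; exact: tsum_linear (smash_mulr_balanced r w).
Qed.

Let linear_mul (V : lmodType k) y (h : V -> RW) :
  linear h -> linear (fun v => smash_mul act y (h v)).
Proof. by move=> hl; apply: linear_compose (smash_mul_linear y) hl. Qed.

Let linear_smash_coact (V : lmodType k) (h : V -> RW) :
  linear h -> linear (fun v => smash_coact (h v)).
Proof. by move=> hl; apply: linear_compose smash_coact_linear hl. Qed.

Ltac lin_extra ::= first [apply: linear_actl | apply: linear_actr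
  | apply: linear_ral | apply: linear_rar | apply: linear_G | apply: linear_g
  | apply: linear_mul | apply: linear_smash_coact].

Lemma tgt_tensr_balanced a :
  balanced (total_ract H smash_f) (lsrc K)
    (fun u w => u ⊗ (tgt K a * w) : UW).
Proof.
split; [lin | lin |].
by move=> u a' w; rewrite tens_mid /lsrc !mulrA src_tgtC.
Qed.

(** As [G] sends [1 # t a] to [t (f a)], this is right [A]-linearity of the coaction before
    transport. *)
Lemma smash_coact_tgt a x :
  smash_coact (smash_mul act ((1 : R) ⊗ tgt K a) x) =
  tens_ract (tgt K) (smash_coact x) a.
Proof.
have bal := tgt_tensr_balanced a; rewrite /tens_ract.
move: x; apply: linear_tensor_ext; [lin | lin |].
move=> r w; rewrite smash_mul_tgtE !smash_coactE comul_tgtl.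
rewrite tsum_comp; last exact: smash_coact_inner_balanced.
rewrite tsum_comp //; apply: eq_tsum => w1 w2.
by rewrite !tsumE //; apply: smash_coact_inner_balanced.
Qed.

Lemma smash_coact_src r x :
  smash_coact (smash_mul act (r ⊗ (1 : W)) x) =
  \tsum_(u, w <- smash_coact x) src H (g r) * u ⊗ w.
Proof.
have bal := @src_tens_balanced _ _ _ _ _ K H smash_f (g r).
move: x; apply: linear_tensor_ext; [lin | lin |].
move=> r' w; rewrite smash_mul_srcE !smash_coactE tsum_comp //.
apply: eq_tsum => w1 w2.
by rewrite tsumE // -smash_mul_srcE GM G_src.
Qed.

Lemma smash_coact_counit x :
  \tsum_(u, w <- smash_coact x) total_ract H smash_f u (counit K w) = G x.
Proof.
have linear_f : linear smash_f by exact: bmor_base_linear smash_morphism.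
have bal : balanced (total_ract H smash_f) (lsrc K)
    (fun u w => total_ract H smash_f u (counit K w)).
  rewrite /total_ract; split=> [w|u|u a w]; first lin.
    apply: linear_kmull; apply: linear_tgt.
    by apply: (linear_compose linear_f); lin.
  have /= fM := bmor_baseM smash_morphism.
  by rewrite /lsrc counit_srcl fM tgtM mulrA.
move: x; apply: linear_tensor_ext; [lin | lin |].
move=> r w; rewrite smash_coactE tsum_comp //.
have lin_r : linear (fun v : W => G (r ⊗ v)) by lin.
rewrite -[w in RHS](comul_counitr K) (linear_tsum_morph _ _ lin_r).
by apply: eq_tsum => w1 w2; rewrite tsumE // G_tgt_mul.
Qed.

Lemma smash_coact_comul x :
  \tsum_(u, w <- smash_coact x) u ⊗ smash_F w = comul H (G x).
Proof.
have bal := tens_morphism_balanced smash_morphism.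
move: x; apply: linear_tensor_ext; [lin | lin |].
move=> r w; rewrite smash_coactE tsum_comp // comulG.
by apply: eq_tsum => w1 w2; rewrite tsumE.
Qed.

Let WW := tensor (fun (w : W) a => tgt K a * w) (fun a (w : W) => src K a * w).
Let UWW :=
  tensor (@tens_ract _ _ _ _ (src K) (tgt K) (total_ract H smash_f)) (lsrc K).

(** This is the image of coassociativity of [comul K] under [w1 (x) w2 |-> G (r # w1) (x) w2],
    extended by the identity on the last leg. *)
Lemma smash_coact_coassocE r w :
  \tsum_(w1, w2 <- comul K w) (smash_coact (r ⊗ w1) ⊗ w2 : UWW) =
  \tsum_(w1, w2 <- comul K w) \tsum_(v1, v2 <- comul K w2)
    (G (r ⊗ w1) ⊗ v1) ⊗ v2.
Proof.
have bal_in := smash_coact_inner_balanced r.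
pose mapG (y : WW) : UW := \tsum_(w1, w2 <- y) G (r ⊗ w1) ⊗ w2.
have bal : balanced (@tens_ract _ _ _ _ (src K) (tgt K) _)
    (fun a w => src K a * w) (fun (y : WW) w => mapG y ⊗ w : UWW).
  rewrite /mapG; split; [lin | lin |].
  move=> y a w'; rewrite -[src K a * w']/(lsrc K a w') -tens_mid.
  congr (_ ⊗ _); rewrite /tens_ract tsum_comp // tsum_comp;
    last exact: tgt_tensr_balanced.
  apply: eq_tsum => w1 w2.
  by rewrite !tsumE //; apply: tgt_tensr_balanced.
have := congr1 (fun z => \tsum_(y, v <- z) (mapG y ⊗ v : UWW)) (comulA K w).
rewrite tsum_comp // tsum_comp // => E.
transitivity (\tsum_(w1, w2 <- comul K w)
  (\tsum_(y, v <- (comul K w1 ⊗ w2 :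
       tensor (@tens_ract _ _ _ _ (src K) (tgt K) _) (fun a u => src K a * u)))
     (mapG y ⊗ v : UWW))).
  by apply: eq_tsum => w1 w2; rewrite tsumE // smash_coactE.
rewrite E; apply: eq_tsum => w1 w2; rewrite tsum_comp //.
by apply: eq_tsum => v1 v2; rewrite tsumE // /mapG tsumE.
Qed.

Context (G' : U -> RW) (g' : B -> R).
Hypotheses (GK : cancel G G') (G'K : cancel G' G) (g'K : cancel g' g).

Definition transported_coact (u : U) : UW := smash_coact (G' u).

Lemma transported_coactE x : transported_coact (G x) = smash_coact x.
Proof. by rewrite /transported_coact GK. Qed.

Let linear_transported (V : lmodType k) (h : V -> U) :
  linear h -> linear (fun v => transported_coact (h v)).
Proof.
move=> hl; apply: linear_smash_coact.
by apply: linear_compose (linear_inverse (bmor_linear morG) GK G'K) hl.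
Qed.

Lemma transported_coact_ract u a :
  transported_coact (total_ract H smash_f u a) =
  tens_ract (tgt K) (transported_coact u) a.
Proof.
rewrite -[u]G'K /total_ract -G_tgt rho_ra1 -GM !transported_coactE.
exact: smash_coact_tgt.
Qed.

Lemma transported_coact_coassoc u :
  \tsum_(u0, u1 <- transported_coact u) (transported_coact u0 ⊗ u1 : UWW) =
  \tsum_(u0, u1 <- transported_coact u) \tsum_(w1, w2 <- comul K u1)
    (u0 ⊗ w1) ⊗ w2.
Proof.
have ball : balanced (total_ract H smash_f) (lsrc K)
    (fun u w => transported_coact u ⊗ w : UWW).
  split=> [w|v|v a w].
  - by apply: linear_tensl; apply: linear_transported; apply: linear_idfun.
  - lin.
  by rewrite transported_coact_ract tens_mid.
have bal_in v : balanced (fun u a => tgt K a * u) (fun a u => src K a * u)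
    (fun w1 w2 => (v ⊗ w1 : UW) ⊗ w2 : UWW).
  split; [lin | lin |].
  move=> w1 a w2; rewrite -[src K a * w2]/(lsrc K a w2) -tens_mid.
  by congr (_ ⊗ _); rewrite /tens_ract tsumE //; apply: tgt_tensr_balanced.
have balr : balanced (total_ract H smash_f) (lsrc K)
    (fun u w => \tsum_(w1, w2 <- comul K w) (u ⊗ w1) ⊗ w2 : UWW).
  split=> [w|v|v a w]; first lin.
    by have := bal_in v; lin.
  rewrite /lsrc comul_srcl tsum_comp //; apply: eq_tsum => w1 w2.
  by rewrite tsumE // tens_mid.
(* Writing [u] as [G x] reduces the claim to [x] a pure tensor, where [smash_coact_coassocE]
   applies. *)
rewrite -[u]G'K transported_coactE; move: (G' u).
apply: linear_tensor_ext; [lin | lin |].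
move=> r w; rewrite smash_coactE tsum_comp // tsum_comp //.
transitivity (\tsum_(w1, w2 <- comul K w) (smash_coact (r ⊗ w1) ⊗ w2 : UWW)).
  by apply: eq_tsum => w1 w2; rewrite tsumE // transported_coactE.
rewrite smash_coact_coassocE; apply: eq_tsum => w1 w2.
by rewrite tsumE.
Qed.

Lemma transported_coact_comodule : right_comodule transported_coact.
Proof.
have /= f1 := bmor_base1 smash_morphism.
have /= fM := bmor_baseM smash_morphism.
split=> [a|u|u|u a b|||u|u].
- by rewrite /total_ract; lin.
- apply: linear_kmull; apply: linear_tgt.
  exact: bmor_base_linear smash_morphism.
- by rewrite /total_ract f1 tgt1 mul1r.
- by rewrite /total_ract fM tgtM mulrA.
- by apply: linear_transported; apply: linear_idfun.
- exact: transported_coact_ract.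
- exact: transported_coact_coassoc.
by rewrite -[u in RHS]G'K -smash_coact_counit.
Qed.

Lemma smash_conditions : action_conditions smash_F transported_coact.
Proof.
split=> [||b u|u|w].
- exact: smash_morphism.
- exact: transported_coact_comodule.
(* Surjectivity of [g] writes [b] as [g r], so that [s b] is the image of [r # 1]. *)
- rewrite -[u]G'K -[b]g'K -G_src -GM !transported_coactE G_src.
  exact: smash_coact_src.
- by rewrite -[u]G'K transported_coactE smash_coact_comul.
by rewrite transported_coactE smash_coactE.
Qed.

End Isomorphism.
End SmashProduct.

Theorem theorem2p5 (k : comPzRingType) (B U : kalgType k)
    (H : left_bialgebroid B U) :
  (action_left_bialgebroid H <->
     exists (A W : kalgType k) (K : left_bialgebroid A W)
       (F : W -> U) (f : A -> B) (rho : U -> tensor (total_ract H f) (lsrc K)),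
       action_conditions F rho)
  /\
  (forall (A W : kalgType k) (K : left_bialgebroid A W)
     (F : W -> U) (f : A -> B) (rho : U -> tensor (total_ract H f) (lsrc K)),
     action_conditions F rho ->
     exists xi : {linear tensor (base_ract f) (lsrc K) -> U},
       [/\ forall b w, xi (b ⊗ w) = src H b * F w,
           forall (b : B) (x : tensor (base_ract f) (lsrc K)),
             xi (\tsum_(b', w <- x) (b * b') ⊗ w) = src H b * xi x,
           cancel xi (fun u => \tsum_(u0, u1 <- rho u) counit H u0 ⊗ u1),
           cancel (fun u => \tsum_(u0, u1 <- rho u) counit H u0 ⊗ u1) xi &
           exists (act : W -> B -> B)
             (coact : B -> tensor (base_ract f) (lsrc K)),
             [/\ yd_monoid act coact, braided_commutative act coact &
                 @bialgebroid_iso k (smash act coact) H xi id]]).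
Proof.
split=> [|A W K F f rho cond]; last first.
  pose xiL := GRing.isLinear.Build k _ U *:%R _ (xi_linear cond).
  pose xi' : {linear tensor (base_ract f) (lsrc K) -> U} :=
    HB.pack (xi H F (f := f)) xiL.
  exists xi'; split.
  - exact: (xiE cond).
  - exact: (xi_mull cond).
  - exact: (xiK cond).
  - exact: (etaK cond).
  exists (base_act H F), (base_coact rho); split.
  - exact: base_yd_monoid cond.
  - exact: base_braided_commutative cond.
  exact: xi_iso cond.
split=> [[A [W [K [R [act [ra [rho [ydR _ [G [g isoG]]]]]]]]]]|].
  have [_ [G' GK G'K] [g' _ g'K]] := isoG.
  exists A, W, K, (smash_F G), (smash_f ra g), (transported_coact G g G').
  exact: (smash_conditions ydR isoG GK G'K g'K).
move=> [A [W [K [F [f [rho cond]]]]]].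
(* The monoid [R] is [B] itself, and the isomorphism is the identity on bases. *)
exists A, W, K, B, (base_act H F), (base_ract f), (base_coact rho); split.
- exact: base_yd_monoid cond.
- exact: base_braided_commutative cond.
by exists (xi H F (f:=f)), id; exact: xi_iso cond.
Qed.
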